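(* Let $V$ be a ground set of $n$ elements with $n$ sufficiently large, $f$ a nonnegative monotone submodular function on $V$ (value oracle), $m$ an integer with $m>2\sqrt{n/\ln n}$, $B>0$ and $p\in(0,1)$; let $c=1/(4\sqrt{2\pi})$. Consider the procedure: if $f(\{v\})\ge B$ for some $v\in V$, return ''fail''. Let $\alpha=Bm/\sqrt{n\ln n}$, $V'=V$. While $|V'|>m\sqrt{n/\ln n}$: choose a random $S\subseteq V'$ including each element independently with probability $\frac{n}{m|V'|}$; if $|S|\le 2n/m$, let $T\subseteq S$ minimize $f(T)-\alpha|T|$ over subsets of $S$, and if $f(T)-\alpha|T|<0$ record $T$ as a new set $T_i$ and set $V'\leftarrow V'\setminus T$; if the number of iterations exceeds $\frac{2n^3}{c}\ln\frac{n}{1-p}$, return ''fail''. After the loop, partition the collection of recorded sets $T_i$ into $m$ groups $\mathcal{T}_1,\dots,\mathcal{T}_m$ such that $\sum_{T_i\in\mathcal{T}_j}|T_i|\le 3n/m$ for each $j$; partition $V'$ into $m$ sets $U_1,\dots,U_m$ each of size at most $\sqrt{n/\ln n}$; output $V_j=U_j\cup\bigcup_{T_i\in\mathcal{T}_j}T_i$, $j=1,\dots,m$. If the instance is feasible, this procedure outputs a partition $\{V_1,\dots,V_m\}$ of $V$ with $\max_j f(V_j)\le 4\sqrt{\frac{n}{\ln n}}\cdot B$ with probability at least $p$.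
   Context: $f:2^V\to\mathbb{R}_{\ge0}$ is submodular if $f(S)+f(T)\ge f(S\cup T)+f(S\cap T)$, monotone if $f(S)\le f(T)$ for $S\subseteq T$. Uniform Submodular Load Balancing: find a partition of $V$ into $m$ (possibly empty) sets minimizing the maximum $f$-value of a part. An instance with target $B$ is feasible if there is a partition $U_1^*,\dots,U_m^*$ of $V$ with $\max_j f(U_j^* )<B$. The minimization of $f(T)-\alpha|T|$ is exact submodular minimization.
   Formalization: If V' cannot be split into m sets of integer size at most √(n/ln n) (possible even when |V'| ≤ m√(n/ln n)), the last step is impossible; then sizes up to ⌈|V'|/m⌉ are allowed and only the existence of a grouping and split meeting the bound is claimed. Otherwise the claim is unchanged. *)

(* Defs.v *)
From mathcomp Require Import all_boot all_order all_algebra.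
From mathcomp Require Import all_classical all_reals all_analysis.

Set Implicit Arguments.
Unset Strict Implicit.
Unset Printing Implicit Defensive.

Import Order.TTheory GRing.Theory Num.Theory.

Local Open Scope ring_scope.

(* Finitely supported distributions, as lists of (weight, value) pairs. *)
Definition dist (R : realType) (A : Type) := seq (R * A).

Definition dret (R : realType) (A : Type) (a : A) : dist R A := [:: (1, a)].

Definition dbind (R : realType) (A C : Type) (d : dist R A) (k : A -> dist R C) :
    dist R C :=
  flatten [seq [seq (x.1 * y.1, y.2) | y <- k x.2] | x <- d].

Definition Pr (R : realType) (A : Type) (d : dist R A) (E : A -> Prop) : R :=
  \sum_(x <- d | `[< E x.2 >]) x.1.

(* Each element of W is included independently with probability q. *)
Definition drandset (R : realType) (V : finType) (W : {set V}) (q : R) :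
    dist R {set V} :=
  [seq (\prod_(v in W) (if v \in A then q else 1 - q), A)
     | A : {set V} <- enum (powerset W)].

Definition submodular (R : realType) (V : finType) (f : {set V} -> R) : Prop :=
  forall S T : {set V}, f (S :|: T) + f (S :&: T) <= f S + f T.

Definition monotone_set (R : realType) (V : finType) (f : {set V} -> R) : Prop :=
  forall S T : {set V}, S \subset T -> f S <= f T.

(* Unlike the finset predicate [partition], the parts are indexed and may be
   empty. *)
Definition mpartition (V : finType) (m : nat) (W : {set V})
    (U : 'I_m -> {set V}) : Prop :=
  \bigcup_j U j = W /\ forall i j, i != j -> [disjoint U i & U j].

(* The default 0 is harmless: f is nonnegative throughout. *)
Definition maxload (R : realType) (V : finType) (f : {set V} -> R) (m : nat)
    (U : 'I_m -> {set V}) : R :=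
  \big[Num.max/0]_(j < m) f (U j).

Definition feasible (R : realType) (V : finType) (f : {set V} -> R) (m : nat)
    (B : R) : Prop :=
  exists U : 'I_m -> {set V}, mpartition [set: V] U /\ maxload f U < B.

(* sqrt (n / ln n) *)
Definition rho (R : realType) (n : nat) : R := Num.sqrt (n%:R / ln n%:R).

Definition alpha (R : realType) (n m : nat) (B : R) : R :=
  B * m%:R / Num.sqrt (n%:R * ln n%:R).

Definition cst_c (R : realType) : R := 1 / (4 * Num.sqrt (2 * pi)).

Definition iter_bound (R : realType) (n : nat) (p : R) : R :=
  2 * n%:R ^+ 3 / cst_c R * ln (n%:R / (1 - p)).

Definition minimizes (R : realType) (V : finType) (f : {set V} -> R) (a : R)
    (S T : {set V}) : Prop :=
  T \subset S /\
  forall T' : {set V}, T' \subset S -> f T - a * #|T|%:R <= f T' - a * #|T'|%:R.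

Record state (V : finType) := State {
  rest : {set V};             (* V' *)
  recorded : seq {set V}      (* the sets T_i, latest first *)
}.

(* A choice of the minimizer T, possibly depending on the current state. *)
Definition minimizer_rule (R : realType) (V : finType) (f : {set V} -> R) (a : R)
    (sel : state V -> {set V} -> {set V}) : Prop :=
  forall (st : state V) (S : {set V}), minimizes f a S (sel st S).

Definition step (R : realType) (V : finType) (f : {set V} -> R) (m : nat) (a : R)
    (sel : state V -> {set V} -> {set V}) (st : state V) (S : {set V}) : state V :=
  if #|S|%:R <= 2 * #|V|%:R / m%:R :> R then
    let T := sel st S in
    if f T - a * #|T|%:R < 0 then State (rest st :\: T) (T :: recorded st)
    else st
  else st.

(* k is the number of iterations still allowed. An iteration entered with k = 0
   would exceed the bound and return "fail" (None) whatever set it draws. *)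
Fixpoint loop (R : realType) (V : finType) (f : {set V} -> R) (m : nat) (a : R)
    (sel : state V -> {set V} -> {set V}) (k : nat) (st : state V) :
    dist R (option (state V)) :=
  if m%:R * rho R #|V| < #|rest st|%:R then
    if k is k'.+1 then
      dbind (drandset (rest st) (#|V|%:R / (m%:R * #|rest st|%:R)))
            (fun S => loop f m a sel k' (step f m a sel st S))
    else dret R None
  else dret R (Some st).

(* The random part of the procedure: None is "fail", and Some st is the state in
   which the while loop is left. *)
Definition sampling (R : realType) (V : finType) (f : {set V} -> R) (m : nat)
    (B p : R) (sel : state V -> {set V} -> {set V}) : dist R (option (state V)) :=
  if [exists v, B <= f [set v]] then dret R None
  else loop f m (alpha #|V| m B) sel (Num.truncn (iter_bound #|V| p))
         (State [set: V] [::]).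

(* The part of the procedure after the loop, with size bound b for the sets U_j:
   W is a possible output. The recorded sets are nonempty and pairwise disjoint,
   hence distinct, so that a partition of the collection into m groups is a map g
   from sets to group indices. *)
Definition output (R : realType) (V : finType) (m : nat) (b : R) (st : state V)
    (W : 'I_m -> {set V}) : Prop :=
  exists (g : {set V} -> 'I_m) (U : 'I_m -> {set V}),
    [/\ forall j, (\sum_(T <- recorded st | g T == j) #|T|)%N%:R
                    <= 3 * #|V|%:R / m%:R :> R,
        mpartition (rest st) U,
        forall j, #|U j|%:R <= b
      & forall j, W j = U j :|: \bigcup_(T <- recorded st | g T == j) T].

(* max (sqrt (n / ln n)) (ceil (|V'| / m)): equal to sqrt (n / ln n) whenever V'
   can be split into m sets of size at most sqrt (n / ln n); otherwise (which
   |V'| <= m sqrt (n / ln n) does not exclude, as sizes are integers) the least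
   size for which a split exists, i.e. sqrt (n / ln n) rounded up. *)
Definition rho_up (R : realType) (V : finType) (m : nat) (st : state V) : R :=
  Num.max (rho R #|V|) ((#|rest st| + m.-1) %/ m)%N%:R.

Definition good (R : realType) (V : finType) (f : {set V} -> R) (m : nat) (B : R)
    (W : 'I_m -> {set V}) : Prop :=
  mpartition [set: V] W /\ maxload f W <= 4 * rho R #|V| * B.

(* Sanity checks: these lists are probability distributions. *)
Definition mass (R : realType) (A : Type) (d : dist R A) : R := \sum_(x <- d) x.1.

Lemma mass_dret (R : realType) (A : Type) (a : A) : mass (dret R a) = 1.
Proof. by rewrite /mass big_seq1. Qed.

Lemma mass_dbind (R : realType) (A C : Type) (d : dist R A) (k : A -> dist R C) :
  (forall a, mass (k a) = 1) -> mass (dbind d k) = mass d.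
Proof.
move=> k1; rewrite /mass /dbind big_flatten big_map.
apply: eq_bigr => x _; rewrite big_map /= -mulr_sumr.
by rewrite -/(mass (k x.2)) k1 mulr1.
Qed.

Lemma mass_drandset (R : realType) (V : finType) (W : {set V}) (q : R) :
  mass (drandset W q) = 1.
Proof.
pose F v := if v \in W then q else 0.
pose G v := if v \in W then 1 - q else 1.
have <- : \prod_(v : V) (F v + G v) = 1.
  rewrite big1 // => v _; rewrite /F /G.
  by case: ifP => _; rewrite ?add0r // addrC subrK.
rewrite bigA_distr /mass /drandset big_map big_enum /=.
rewrite [RHS](bigID (fun A : {set V} => A \subset W)) /= [X in _ = _ + X]big1 ?addr0.
  apply: eq_big => [A|A]; first by rewrite powersetE.
  rewrite powersetE => /fintype.subsetP AW; rewrite big_mkcond; apply: eq_bigr => v _.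
  by rewrite /F /G; have [vA|vA] := boolP (v \in A); first by rewrite (AW _ vA).
move=> A /fintype.subsetPn[v vA vW].
by rewrite (bigD1 v) //= vA /F (negbTE vW) mul0r.
Qed.

Lemma drandset_ge0 (R : realType) (V : finType) (W : {set V}) (q : R) :
  0 <= q <= 1 -> forall E, 0 <= Pr (drandset W q) E.
Proof.
move=> /andP[q0 q1] E; rewrite /Pr /drandset big_map.
apply: sumr_ge0 => S _; apply: prodr_ge0 => v _.
by case: ifP => // _; rewrite subr_ge0.
Qed.

Lemma mass_loop (R : realType) (V : finType) (f : {set V} -> R) (m : nat) (a : R)
    (sel : state V -> {set V} -> {set V}) (k : nat) (st : state V) :
  mass (loop f m a sel k st) = 1.
Proof.
elim: k st => [|k IH] st /=; case: ifP => _; rewrite ?mass_dret //.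
by rewrite mass_dbind ?mass_drandset.
Qed.

Lemma mass_sampling (R : realType) (V : finType) (f : {set V} -> R) (m : nat)
    (B p : R) (sel : state V -> {set V} -> {set V}) :
  mass (sampling f m B p sel) = 1.
Proof. by rewrite /sampling; case: ifP => _; [exact: mass_dret|exact: mass_loop]. Qed.

(* Main.v *)
Require Import Defs.
From mathcomp Require Import all_boot all_order all_algebra.
From mathcomp Require Import all_classical all_reals all_analysis.
(* Imported again so that [subsetP], [setIC], etc. denote the lemmas on [{set V}]
   rather than their namesakes on classical sets. *)
From mathcomp Require Import fintype finset ring lra zify.

Set Implicit Arguments.
Unset Strict Implicit.
Unset Printing Implicit Defensive.

Import Order.TTheory GRing.Theory Num.Theory.

Local Open Scope ring_scope.

(* Write [N = n], [l = ln n], [rho = sqrt (n / l)]. In every iteration some part of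
   the feasible partition meets [V'] in at least [|V'| / m] elements. Let [A]
   consist of [ceil (|V'| / m)] of them. If [|S :&: A| = t >= rho * l / m], then
   [f (S :&: A) < B <= alpha * t], so [S :&: A] already makes the minimum negative.
   The expected size of [S :&: A] is about [n / m ^ 2], and the explicit binomial
   probability of hitting [t] is at least [1 / n ^ 2]; independently, by Markov, the
   rest of [S] has size at most [2 n / m - t] with probability at least [1 / 3].
   Hence [V'] shrinks with probability at least [1 / (3 n ^ 2)], and the potential
   [2 ^ |V'|] bounds the probability that the iterations run out. After the loop,
   subadditivity gives load at most [B * |U_j| + alpha * (sum of |T_i|)], and a
   greedy assignment provides the groups. *)

(** * Probabilities of events in finitely supported distributions *)

Section Distributions.
Variable R : realType.

Lemma Pr_dret (A : Type) (a : A) (E : A -> Prop) : E a -> Pr (dret R a) E = 1.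
Proof. by move=> Ea; rewrite /Pr big_mkcond big_seq1 /=; case: asboolP. Qed.

Lemma Pr_dbind (A C : Type) (d : dist R A) (k : A -> dist R C) (E : C -> Prop) :
  Pr (dbind d k) E = \sum_(x <- d) x.1 * Pr (k x.2) E.
Proof.
rewrite /Pr /dbind big_mkcond big_flatten big_map; apply: eq_bigr => x _.
by rewrite big_map mulr_sumr [RHS]big_mkcond.
Qed.

Lemma Pr_dret_ge0 (A : Type) (a : A) (E : A -> Prop) : 0 <= Pr (dret R a) E.
Proof. by rewrite /Pr big_mkcond big_seq1 /=; case: asboolP. Qed.

End Distributions.

(** * Random subsets with independent inclusions *)

Section RandomSets.
Variables (R : realType) (V : finType).
Implicit Types (W A S : {set V}) (q : R).

Definition setwt W q S : R := \prod_(v in W) (if v \in S then q else 1 - q).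

Lemma setwt_ge0 W q S : 0 <= q <= 1 -> 0 <= setwt W q S.
Proof.
move=> /andP[q0 q1]; apply: prodr_ge0 => v _.
by case: ifP => // _; rewrite subr_ge0.
Qed.

Lemma sum_drandset W q (F : {set V} -> R) :
  \sum_(x <- drandset W q) x.1 * F x.2 =
  \sum_(S in powerset W) setwt W q S * F S.
Proof. by rewrite big_map big_enum. Qed.

Lemma sum_setwt W q : \sum_(S in powerset W) setwt W q S = 1.
Proof. by rewrite -[RHS](mass_drandset W q) /mass big_map big_enum. Qed.

(** Independence of the traces of [S] on and off [A]: [S] corresponds to the pair
    [(S :&: A, S :\: A)], and its weight factors accordingly. *)
Lemma sum_setwt_split W A q (F G : {set V} -> R) : A \subset W ->
  \sum_(S in powerset W) setwt W q S * (F (S :&: A) * G (S :\: A)) =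
  (\sum_(S in powerset A) setwt A q S * F S) *
  (\sum_(S in powerset (W :\: A)) setwt (W :\: A) q S * G S).
Proof.
move=> AW; rewrite big_distrlr /= pair_big /=.
rewrite (reindex_onto (fun X : {set V} * {set V} => X.1 :|: X.2)
           (fun S => (S :&: A, S :\: A))) /=; last first.
  by move=> S _; rewrite setID.
apply: eq_big => [[X Y]|[X Y] /andP[_ /eqP[eX eY]]] /=.
  rewrite !powersetE; apply/andP/andP => [[XYW /eqP[eX eY]]|[XA YWA]].
    split; first by rewrite -eX subsetIr.
    by rewrite -eY setSD.
  split.
    by rewrite subUset (subset_trans XA AW) (subset_trans YWA (subsetDl _ _)).
  have YA : [disjoint Y & A].
    by move: YWA; rewrite subsetD => /andP[].
  apply/eqP; congr (_, _).
    rewrite setIUl (setIidPl XA); move: YA; rewrite -setI_eq0 => /eqP->.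
    by rewrite setU0.
  rewrite setDUl; move: XA; rewrite -setD_eq0 => /eqP ->; rewrite set0U.
  by apply/setDidPl.
rewrite !eX !eY mulrACA; congr (_ * _).
rewrite /setwt (big_setID A) /= (setIidPr AW); congr (_ * _).
  by apply: eq_bigr => v vA; rewrite -[in RHS]eX !inE vA andbT.
by apply: eq_bigr => v; rewrite inE => /andP[vA _]; rewrite -[in RHS]eY !inE vA.
Qed.

Lemma setwt_card A q S : S \subset A ->
  setwt A q S = q ^+ #|S| * (1 - q) ^+ (#|A| - #|S|).
Proof.
move=> SA; rewrite /setwt (big_setID S) /= (setIidPr SA); congr (_ * _).
  by rewrite -prodr_const; apply: eq_bigr => v ->.
rewrite -cardsDS// -prodr_const; apply: eq_bigr => v.
by rewrite inE => /andP[/negbTE ->].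
Qed.

Lemma sum_setwt_card_eq A q (t : nat) :
  \sum_(S in powerset A) setwt A q S * (#|S| == t)%:R =
  'C(#|A|, t)%:R * q ^+ t * (1 - q) ^+ (#|A| - t).
Proof.
rewrite -cards_draws -mulrA mulr_natl -sumr_const.
rewrite [RHS](eq_bigl (fun S : {set V} => (S \in powerset A) && (#|S| == t))); last first.
  by move=> S; rewrite !inE.
rewrite [RHS]big_mkcondr; apply: eq_bigr => S; rewrite powersetE => SA.
by case: eqP => [<-|_]; rewrite ?mulr0// mulr1 setwt_card.
Qed.

Lemma sum_setwt_mem W q v : v \in W ->
  \sum_(S in powerset W) setwt W q S * (v \in S)%:R = q.
Proof.
move=> vW.
(* Membership of [v] means that the trace on [[set v]] has cardinality 1, so the splitting
   applies. *)
transitivity (\sum_(S in powerset W) setwt W q S * ((#|S :&: [set v]| == 1%N)%:R * 1)).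
  apply: eq_bigr => S _; rewrite mulr1 setIC; congr (_ * _%:R).
  have [vS|vS] := boolP (v \in S).
    by rewrite (setIidPl _) ?cards1// sub1set.
  by move: vS; rewrite -disjoints1 -setI_eq0 => /eqP ->; rewrite cards0.
have v1W : [set v] \subset W by rewrite sub1set.
rewrite (sum_setwt_split q (fun S => (#|S| == 1%N)%:R) (fun=> 1) v1W).
rewrite sum_setwt_card_eq cards1 binn mul1r subnn expr0 mulr1 expr1.
by under eq_bigr do rewrite mulr1; rewrite sum_setwt mulr1.
Qed.

Lemma sum_setwt_card W q :
  \sum_(S in powerset W) setwt W q S * #|S|%:R = q * #|W|%:R.
Proof.
transitivity (\sum_(S in powerset W) \sum_(v in W) setwt W q S * (v \in S)%:R).
  apply: eq_bigr => S; rewrite powersetE => SW; rewrite -mulr_sumr; congr (_ * _).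
  rewrite -natr_sum -sum1_card big_mkcond/= [in RHS]big_mkcond/=; congr _%:R.
  by apply: eq_bigr => v _; case: ifPn => [/(subsetP SW)->|]//; case: ifP.
rewrite exchange_big /= (eq_bigr (fun=> q)); last by move=> v; exact: sum_setwt_mem.
by rewrite sumr_const mulr_natr.
Qed.

(** Markov's inequality: 1 is at most the indicator of [#|S| <= L] plus [#|S| / L]. *)
Lemma setwt_markov W q (L : R) : 0 <= q <= 1 -> 0 < L ->
  1 - q * #|W|%:R / L <=
  \sum_(S in powerset W) setwt W q S * (#|S|%:R <= L)%R%:R.
Proof.
move=> q01 L0; rewrite lerBlDr -sum_setwt_card mulr_suml -big_split /=.
rewrite -[leLHS](sum_setwt W q); apply: ler_sum => S _.
rewrite -mulrA -mulrDr ler_peMr ?setwt_ge0//.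
case: (leP #|S|%:R L) => [_|Ls] /=; first by rewrite lerDl divr_ge0// ltW.
by rewrite add0r ler_pdivlMr// mul1r ltW.
Qed.

(** The trace on [A] has binomial size and is independent of the rest, to which Markov applies. *)
Lemma setwt_hit W A q (t : nat) (L : R) : A \subset W -> 0 <= q <= 1 -> 0 < L ->
  'C(#|A|, t)%:R * q ^+ t * (1 - q) ^+ (#|A| - t) * (1 - q * #|W|%:R / L) <=
  \sum_(S in powerset W)
     setwt W q S * ((#|S :&: A| == t) && (#|S :\: A|%:R <= L))%R%:R.
Proof.
move=> AW q01 L0; under eq_bigr do rewrite -mulnb natrM.
rewrite (sum_setwt_split q (fun S => (#|S| == t)%:R) (fun S => (#|S|%:R <= L)%R%:R) AW).
have /andP[q0 q1] := q01.
rewrite sum_setwt_card_eq ler_wpM2l//.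
  by rewrite !mulr_ge0// exprn_ge0// subr_ge0.
apply: le_trans (setwt_markov (W :\: A) q01 L0).
rewrite lerD2l lerN2 ler_pM2r ?invr_gt0// ler_wpM2l// ler_nat.
exact: subset_leq_card (subsetDl _ _).
Qed.

End RandomSets.

(** Induction through [(t + 1) * C(a + 1, t + 1) = (a + 1) * C(a, t)], using
    [(a + 1) / (t + 1) <= a / t] for [0 < t <= a]. *)
Lemma expn_le_bin (a t : nat) : (t <= a)%N -> (a ^ t <= 'C(a, t) * t ^ t)%N.
Proof.
elim: t a => [|t IH] [|a]// ta.
rewrite !expnS [leqRHS]mulnA [('C(a.+1, _) * _)%N]mulnC -mul_bin_diag -mulnA leq_mul2l /=.
case: t ta IH => [|t] ta IH; first by rewrite bin0.
have := IH a ta; rewrite -(@leq_pmul2r (t.+2 ^ t.+1)) ?expn_gt0// => {}IH.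
rewrite -(@leq_pmul2r (t.+1 ^ t.+1)) ?expn_gt0//.
rewrite [leqRHS](_ : _ = 'C(a, t.+1) * t.+1 ^ t.+1 * t.+2 ^ t.+1)%N; last by ring.
apply: leq_trans IH; rewrite -!expnMn leq_exp2r//; nia.
Qed.

(** * Numerical estimates for one iteration *)

Section Estimates.
Variable R : realType.

Lemma exprn_div_le_bin (a t : nat) : (0 < t <= a)%N ->
  (a%:R / t%:R) ^+ t <= 'C(a, t)%:R :> R.
Proof.
move=> /andP[t0 ta]; rewrite expr_div_n ler_pdivrMr ?exprn_gt0 ?ltr0n//.
by rewrite -!natrX -natrM ler_nat expn_le_bin.
Qed.

(** By inversion: [1 / (1 - q) <= 1 + 2 * q <= expR (2 * q)]. *)
Lemma expR_le_1Bx (q : R) : 0 <= q <= 1/2 -> expR (- (2 * q)) <= 1 - q.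
Proof.
move=> /andP[q0 q1].
rewrite expRN -[leRHS]invrK lef_pV2 ?posrE ?invr_gt0 ?expR_gt0; [|lra..].
apply: le_trans (expR_ge1Dx _); rewrite -div1r ler_pdivrMr; [nra|lra].
Qed.

Variables (N l rho : R) (m r a t : nat).
Hypotheses (l1 : 1 <= l) (rho4 : 4 * l <= rho) (expl : expR l = N)
  (Nrho : N = rho ^+ 2 * l) (hl : expR 3 * l <= expR (l / 2)).
Hypotheses (hm : 2 * rho < m%:R) (hr : m%:R * rho < r%:R) (hrN : r%:R <= N).
Hypothesis ha : r%:R / m%:R <= (a%:R : R) <= r%:R / m%:R + 1.
Hypothesis ht : rho * l / m%:R <= t%:R <= rho * l / m%:R + 1.

Let rho_gt0 : 0 < rho. Proof. by move: l1 rho4; lra. Qed.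
Let m_gt0 : 0 < m%:R :> R. Proof. by move: rho_gt0 hm; lra. Qed.
Let r_gt0 : 0 < r%:R :> R.
Proof. by apply: le_lt_trans hr; rewrite mulr_ge0// ltW. Qed.

(** The loop condition gives [m * rho < r <= N = rho ^ 2 * l]. *)
Lemma loop_m_lt : m%:R < rho * l.
Proof.
rewrite -(ltr_pM2r rho_gt0) (lt_le_trans hr)// (le_trans hrN)// Nrho.
by rewrite expr2 mulrAC.
Qed.

(** The estimates run through [x], with [2 < x < l], and [t0], the size to be hit before rounding.
    Here [t0 * x = l], and [t0 / x = N / m ^ 2] is the expected size of [S :&: A] up to the rounding
    of [#|A|]. *)
Let x := m%:R / rho.
Let t0 := rho * l / m%:R.
Let q := N / (m%:R * r%:R).

Let x_gt2 : 2 < x. Proof. by rewrite /x ltr_pdivlMr. Qed.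
Let x_lt : x < l. Proof. by rewrite /x ltr_pdivrMr// mulrC; exact: loop_m_lt. Qed.
Let t0_gt1 : 1 < t0.
Proof. by rewrite /t0 ltr_pdivlMr// mul1r; exact: loop_m_lt. Qed.
Let t0x : t0 * x = l.
Proof. by rewrite /t0 /x; field; rewrite !gt_eqF. Qed.
Let mux : N / m%:R ^+ 2 = t0 / x.
Proof. by rewrite /t0 /x Nrho; field; rewrite !gt_eqF. Qed.

Ltac lra_loop := move: l1 rho4 x_gt2 x_lt t0_gt1; lra.

(** [m * r >= m ^ 2 * rho >= 4 * rho ^ 3], while [N = rho ^ 2 * l <= 2 * rho ^ 3]. *)
Lemma loop_prob : 0 <= q <= 1 / 2.
Proof.
apply/andP; split; first by rewrite divr_ge0 ?mulr_ge0 -?expl ?expR_ge0// ltW.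
rewrite ler_pdivrMr ?mulr_gt0//.
have h1 : m%:R * (m%:R * rho) <= m%:R * r%:R by rewrite ler_pM2l// ltW.
have h2 : 2 * rho * (2 * rho) <= m%:R * m%:R.
  by rewrite ler_pM// ?mulr_ge0// ltW.
have h3 : 2 * rho * (2 * rho) * rho <= m%:R * m%:R * rho by rewrite ler_pM2r.
have h4 : rho ^+ 2 * l <= rho ^+ 2 * (2 * rho).
  by rewrite ler_pM2l ?exprn_gt0//; move: rho4 l1; lra.
rewrite Nrho; move: rho4 l1; lra.
Qed.

Lemma loop_t_le_a : (t <= a)%N.
Proof.
have h : rho < r%:R / m%:R by rewrite ltr_pdivlMr// mulrC.
have h2 : t0 <= l / 2.
  rewrite -t0x -mulrA ler_peMr//; [by rewrite ltW// (lt_trans _ t0_gt1)|].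
  by rewrite ler_pdivlMr// mul1r ltW.
move: ha ht => /andP[ha1 _] /andP[_ ht2]; rewrite -(@ler_nat R).
by move: h h2; rewrite /t0; lra_loop.
Qed.

Lemma loop_t_gt0 : (0 < t)%N.
Proof. by move: ht => /andP[+ _]; rewrite -(@ltr0n R); have := t0_gt1; rewrite /t0; lra_loop. Qed.

(** Both [t0] and the rounding error 1 are at most [N / (4 * m)]. *)
Lemma loop_t_small : t%:R <= N / m%:R / 2.
Proof.
have h : rho <= N / m%:R.
  rewrite ler_pdivlMr// Nrho expr2 -mulrA ler_pM2l// ltW//; exact: loop_m_lt.
have h2 : 4 * t0 <= N / m%:R.
  rewrite /t0 Nrho mulrA ler_pM2r ?invr_gt0// mulrA expr2 ler_pM2r; [|lra_loop].
  by rewrite ler_pM2r//; lra_loop.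
by move: ht => /andP[_]; rewrite -/t0; lra_loop.
Qed.

(* Up to the factors [expR 2] and [x], both at most polylogarithmic, this is
   [x ^ (l / x) <= expR l] with [l = ln N]. *)
Let ratio_pow : (t%:R / (t0 / x)) ^+ t <= expR 2 * (x * N).
Proof.
have x0 : 0 < x by lra_loop.
have t00 : 0 < t0 by lra_loop.
have tt : t%:R <= t0 + 1 by case/andP: ht.
(* Rounding costs a factor [1 + 1 / t0 <= expR (1 / t0)], whose [t]-th power is at most [expR 2]
   because [t <= t0 + 1 <= 2 * t0]. *)
have e1 : t%:R / (t0 / x) <= x * expR (1 / t0).
  rewrite invf_div mulrCA ler_pM2l//.
  apply: le_trans (expR_ge1Dx _); rewrite ler_pdivrMr// mulrDl.
  by rewrite divfK ?gt_eqF // mul1r.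
apply: (@le_trans _ _ ((x * expR (1 / t0)) ^+ t)).
  apply: lerXn2r; rewrite ?nnegrE //; last by rewrite mulr_ge0 ?expR_ge0 // ltW.
  by rewrite divr_ge0 // divr_ge0 // ltW.
rewrite exprMn [leRHS]mulrC ler_pM ?exprn_ge0 ?expR_ge0 ?(ltW x0) //.
  rewrite -{1}(@lnK R x) ?posrE// -expRM_natl.
  (* [x ^ (t0 + 1) = x * expR (t0 * ln x)], and [t0 * ln x <= t0 * x = l]. *)
  apply: (@le_trans _ _ (expR ((t0 + 1) * ln x))).
    by rewrite ler_expR ler_wpM2r// ln_ge0//; lra_loop.
  rewrite mulrDl mul1r expRD lnK ?posrE// mulrC ler_pM2l// -expl ler_expR -t0x.
  by rewrite ler_pM2l// ltW// ln_sublinear.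
rewrite -expRM_natl ler_expR mul1r ler_pdivrMr//; lra_loop.
Qed.

Lemma loop_binomial_ge :
  1 / N ^+ 2 <= 'C(a, t)%:R * q ^+ t * (1 - q) ^+ (a - t).
Proof.
have q01 := loop_prob; have /andP[q0 q1] := q01.
have x0 : 0 < x by lra_loop.
have t00 : 0 < t0 by lra_loop.
have tR : 0 < t%:R :> R by rewrite ltr0n loop_t_gt0.
have N0 : 0 < N by rewrite -expl expR_gt0.
have [ha1 ha2] := andP ha.
have rmq : r%:R / m%:R * q = t0 / x.
  by rewrite -mux /q; field; rewrite !gt_eqF.
have y0 : 0 < t0 / x by rewrite divr_gt0.
have z0 : 0 < t%:R / (t0 / x) by rewrite divr_gt0.
(* Since [a * q >= t0 / x], the bound [(a / t) ^ t <= C(a, t)] leaves the inverse of the power in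
   [ratio_pow]. *)
have h1 : (expR 2 * (x * N))^-1 <= 'C(a, t)%:R * q ^+ t.
  apply: (@le_trans _ _ ((a%:R / t%:R) ^+ t * q ^+ t)); last first.
    by rewrite ler_wpM2r ?exprn_ge0// exprn_div_le_bin// loop_t_gt0 loop_t_le_a.
  apply: (@le_trans _ _ ((t%:R / (t0 / x)) ^+ t)^-1).
    by rewrite lef_pV2 ?posrE ?(exprn_gt0 _ z0) // mulr_gt0 ?expR_gt0 // mulr_gt0.
  rewrite -exprVn invf_div -exprMn.
  apply: lerXn2r; rewrite ?nnegrE.
  - by rewrite divr_ge0 // ltW.
  - by rewrite mulr_ge0 // divr_ge0.
  - by rewrite [leRHS]mulrAC ler_pM2r ?invr_gt0 // -rmq ler_wpM2r.
(* [2 * a * q <= 2 * (t0 / x + q) <= l / 2 + 1], as [x ^ 2 >= 4] and [q <= 1 / 2]. *)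
have h2 : (expR (l / 2 + 1))^-1 <= (1 - q) ^+ (a - t).
  apply: (@le_trans _ _ ((1 - q) ^+ a)); last first.
    by apply: ler_wiXn2l; rewrite ?leq_subr//; lra_loop.
  apply: (@le_trans _ _ (expR (- (2 * q)) ^+ a)).
    rewrite -expRN -expRM_natl ler_expR mulrN lerN2.
    have : a%:R * q <= t0 / x + q by rewrite -rmq -[X in _ + X]mul1r -mulrDl ler_wpM2r.
    have : t0 / x <= l / 4.
      have x4 : 4 <= x * x by (move: x_gt2; nra).
      have : t0 * 4 <= t0 * (x * x) by rewrite ler_pM2l.
      by rewrite ler_pdivrMr // -t0x; lra.
    lra_loop.
  apply: lerXn2r; rewrite ?nnegrE ?expR_ge0//; [lra_loop|exact: expR_le_1Bx].
(* The product suffices once [expR 3 * x * expR (l / 2) <= N], which follows from [x < l] and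
   [hl]. *)
apply: le_trans (_ : (expR 2 * (x * N))^-1 * (expR (l / 2 + 1))^-1 <= _); last first.
  apply: ler_pM h1 h2; rewrite invr_ge0 ?expR_ge0 //.
  by rewrite mulr_ge0 ?expR_ge0 // mulr_ge0 // ltW.
have xN : 0 < x * N by rewrite mulr_gt0.
rewrite -invfM div1r lef_pV2 ?posrE ?(exprn_gt0 _ N0) //; last first.
  by rewrite mulr_gt0 ?expR_gt0 // mulr_gt0 ?expR_gt0.
rewrite (expRD (l / 2) 1).
have -> : expR 2 * (x * N) * (expR (l / 2) * expR 1) =
   (expR 2 * expR 1 * x) * expR (l / 2) * N by ring.
rewrite -(expRD 2 1) expr2 ler_pM2r // -[leRHS]expl.
have -> : expR l = expR (l / 2) * expR (l / 2) by rewrite -expRD; congr expR; lra_loop.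
rewrite ler_pM2r ?expR_gt0//; apply: le_trans hl.
rewrite (_ : 2 + 1 = 3)//; last by lra_loop.
by rewrite ler_pM2l ?expR_gt0// ltW.
Qed.

End Estimates.

(* Greedy assignment: each item goes to a currently least loaded group. *)
Lemma balanced_assignment (T : eqType) (m b : nat) (w : T -> nat) (s : seq T) :
  (0 < m)%N -> uniq s -> {in s, forall x, (w x <= b)%N} ->
  exists g : T -> 'I_m, forall j,
    (m * \sum_(x <- s | g x == j) w x <= \sum_(x <- s) w x + m.-1 * b)%N.
Proof.
move=> m0; elim: s => [|x s IH] /=.
  by exists (fun=> Ordinal m0) => j; rewrite !big_nil muln0.
move=> /andP[xs us] wb.
have [|g hg] := IH us; first by move=> y ys; apply: wb; rewrite inE ys orbT.
pose load j := (\sum_(y <- s | g y == j) w y)%N.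
pose j0 := [arg min_(j < Ordinal m0) load j].
have minj0 j : (load j0 <= load j)%N.
  by rewrite /j0; case: arg_minnP => // i _; apply.
have avg : (m * load j0 <= \sum_(y <- s) w y)%N.
  rewrite [leqRHS](partition_big g xpredT) //=.
  rewrite -[X in (X * _)%N](card_ord m) -sum_nat_const; apply: leq_sum => j _.
  exact: minj0.
exists (fun y => if y == x then j0 else g y) => j.
rewrite !big_cons eqxx.
(* As [x] does not occur in [s], redefining [g] at [x] changes no earlier load. *)
have -> : (\sum_(y <- s | (if y == x then j0 else g y) == j) w y = load j)%N.
  rewrite /load big_seq_cond [in RHS]big_seq_cond; apply: eq_bigl => y.
  by case: (boolP (y \in s)) => //= ys; case: (y =P x) => // yx; rewrite -yx ys in xs.
have wx : (w x <= b)%N by apply: wb; rewrite mem_head.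
(* In the chosen group, one of the [m] copies of [w x] enters the total, and the other [m - 1] are
   covered by [m.-1 * b]. *)
case: eqP => [<-|_].
  rewrite mulnDr -[X in (X * w x)%N](prednK m0) mulSn.
  have := leq_mul (leqnn m.-1) wx; move: avg; lia.
by apply: leq_trans (hg j) _; rewrite leq_add2r leq_addl.
Qed.

Lemma mem_bigcup_seq (V : finType) (s : seq {set V}) (P : pred {set V}) v :
  (v \in \bigcup_(T <- s | P T) T) = has (fun T => P T && (v \in T)) s.
Proof.
elim: s => [|T s IH]; first by rewrite big_nil inE.
by rewrite big_cons /=; case: (P T); rewrite ?inE IH.
Qed.

(** * Loads of unions through subadditivity *)

Section SetFunctions.
Variables (R : realType) (V : finType) (f : {set V} -> R).
Hypotheses (f_ge0 : forall A, 0 <= f A) (f_sub : submodular f).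

Lemma submodular_setU (A C : {set V}) : f (A :|: C) <= f A + f C.
Proof. by apply: le_trans (f_sub A C); rewrite lerDl. Qed.

(* Only [0 <= f set0] is known, so the empty union is treated apart. *)
Lemma load_le (B a : R) (U : {set V}) (s : seq {set V}) (P : pred {set V}) :
  (forall v, f [set v] <= B) -> f set0 <= B ->
  {in s, forall T, f T <= a * #|T|%:R} ->
  f (U :|: \bigcup_(T <- s | P T) T) <=
  Num.max B (B * #|U|%:R + a * (\sum_(T <- s | P T) #|T|)%N%:R).
Proof.
move=> f1 f0 fs.
(* Resetting the value at [set0] to 0 keeps subadditivity and extends it to all finite unions, the
   empty one included. *)
pose h A := if A == set0 then 0 else f A.
have h_le A : h A <= f A by rewrite /h; case: ifP.
have h0 : h set0 = 0 by rewrite /h eqxx.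
have hU A C : h (A :|: C) <= h A + h C.
  rewrite {1}/h; case: ifPn => [_|AC].
    by apply: addr_ge0; rewrite /h; case: ifP.
  have [A0|A0] := eqVneq A set0.
    by move: AC; rewrite A0 set0U h0 add0r /h => /negbTE ->.
  have [C0|C0] := eqVneq C set0.
    by move: AC; rewrite C0 setU0 h0 addr0 /h => /negbTE ->.
  by rewrite /h (negbTE A0) (negbTE C0) submodular_setU.
have hbig I (r : seq I) (Q : pred I) (F : I -> {set V}) :
    h (\bigcup_(i <- r | Q i) F i) <= \sum_(i <- r | Q i) h (F i).
  apply: (big_ind2 (fun A x => h A <= x)) => [|A x C y hA hC|//].
    by rewrite h0.
  exact: le_trans (hU _ _) (lerD hA hC).
have key : h (U :|: \bigcup_(T <- s | P T) T) <=
    B * #|U|%:R + a * (\sum_(T <- s | P T) #|T|)%N%:R.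
  apply: le_trans (hU _ _) _; apply: lerD.
    have {1}-> : U = \bigcup_(v in U) [set v].
      apply/setP => v; apply/idP/bigcupP => [vU|[w wU]]; last by rewrite inE => /eqP ->.
      by exists v => //; rewrite inE.
    apply: le_trans (hbig _ _ _ _) _; rewrite mulr_natr -sumr_const.
    by apply: ler_sum => v _; apply: le_trans (h_le _) _.
  apply: le_trans (hbig _ _ _ _) _.
  rewrite natr_sum mulr_sumr big_seq_cond [leRHS]big_seq_cond.
  by apply: ler_sum => T /andP[Ts _]; apply: le_trans (h_le _) (fs _ Ts).
rewrite le_max; have [->|W0] := eqVneq (U :|: \bigcup_(T <- s | P T) T) set0.
  by rewrite f0.
by move: key; rewrite /h (negbTE W0) => ->; rewrite orbT.
Qed.

End SetFunctions.

(** Greedy assignment with unit weights; the bound is the ceiling of [#|W| / m]. *)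
Lemma split_set (V : finType) (m : nat) (W : {set V}) : (0 < m)%N ->
  exists U : 'I_m -> {set V},
    mpartition W U /\ forall j, (#|U j| <= (#|W| + m.-1) %/ m)%N.
Proof.
move=> m0; have [||g hg] := @balanced_assignment V m 1 (fun=> 1%N) (enum W) m0.
- exact: enum_uniq.
- by [].
exists (fun j => [set v in W | g v == j]); split=> [|j]; first split.
- apply/setP => v; apply/bigcupP/idP => [[j _]|vW]; first by rewrite inE => /andP[].
  by exists (g v); rewrite ?inE ?vW ?eqxx.
- move=> i j ij; rewrite -setI_eq0; apply/eqP/setP => v; rewrite !inE.
  by apply/negP => /andP[/andP[_ /eqP gi] /andP[_ /eqP gj]]; rewrite -gi -gj eqxx in ij.
have := hg j; rewrite sum1_size -cardE big_enum_cond /= sum1_card muln1.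
rewrite (_ : #|_| = #|[set v in W | g v == j]|); last by apply: eq_card => v; rewrite !inE.
by rewrite leq_divRL// mulnC.
Qed.

(** * The loop invariant and the partition it yields *)

Section Invariant.
Variables (R : realType) (V : finType) (f : {set V} -> R) (m : nat) (a : R).
Implicit Types st : state V.

(** [inv_uniq], [inv_card] and [inv_small] feed the greedy grouping (distinct items, total weight,
    item size); [inv_cheap] bounds the load. *)
Record loop_inv st : Prop := LoopInv {
  inv_uniq : uniq (recorded st);
  inv_disjoint : {in recorded st &, forall T1 T2 : {set V}, T1 != T2 -> [disjoint T1 & T2]};
  inv_rest : {in recorded st, forall T : {set V}, [disjoint rest st & T]};
  inv_cover : forall v, v \in rest st \/ exists2 T, T \in recorded st & v \in T;
  inv_card : (#|rest st| + \sum_(T <- recorded st) #|T| = #|V|)%N;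
  inv_cheap : {in recorded st, forall T : {set V}, f T <= a * #|T|%:R};
  inv_small : {in recorded st, forall T : {set V}, #|T|%:R <= 2 * #|V|%:R / m%:R :> R}
}.

Lemma loop_inv0 : loop_inv (State [set: V] [::]).
Proof.
by split=> //= [v|]; [left; rewrite inE|rewrite big_nil addn0 cardsT].
Qed.

(** At [set0] the objective is [f set0 >= 0]. *)
Lemma cheap_neq0 (T : {set V}) :
  0 <= f set0 -> f T - a * #|T|%:R < 0 -> T != set0.
Proof.
by move=> f0; apply: contraTneq => ->; rewrite cards0 mulr0 subr0 -leNgt.
Qed.

Variable sel : state V -> {set V} -> {set V}.
Hypotheses (f0 : 0 <= f set0) (selP : minimizer_rule f a sel).

Lemma step_inv st (S : {set V}) : S \subset rest st ->
  loop_inv st -> loop_inv (step f m a sel st S).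
Proof.
move=> Sr inv; rewrite /step; case: ifP => // Ssmall; case: ifP => // Tneg.
have [TS _] := selP st S; set T := sel st S in TS Tneg *.
have Tr : T \subset rest st := subset_trans TS Sr.
have dT T' : T' \in recorded st -> [disjoint T & T'].
  by move=> /(inv_rest inv); apply: disjointWl.
split => /=.
(* A set recorded twice would be disjoint from itself, hence empty. *)
- rewrite (inv_uniq inv) andbT; apply/negP => /dT; rewrite -setI_eq0 setIid.
  by apply/negP; exact: cheap_neq0 Tneg.
- move=> T1 T2; rewrite !inE => /predU1P[->|T1r] /predU1P[->|T2r] T12.
  + by rewrite eqxx in T12.
  + exact: dT.
  + by rewrite disjoint_sym dT.
  + exact: (inv_disjoint inv).
- move=> T'; rewrite inE => /predU1P[->|T'r]; last first.
    by apply: disjointWl (inv_rest inv T'r); apply: subsetDl.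
  by rewrite -setI_eq0 setDE -setIA setICA setIC -setIA setICr setI0.
- move=> v; have [vT|vT] := boolP (v \in T).
    by right; exists T; rewrite ?mem_head.
  have [vr|[T' T'r vT']] := inv_cover inv v; first by left; rewrite inE vT.
  by right; exists T' => //; rewrite inE T'r orbT.
- rewrite big_cons addnA cardsDS// subnK ?subset_leq_card//.
  exact: inv_card.
- move=> T'; rewrite inE => /predU1P[->|]; last exact: inv_cheap.
  by rewrite -subr_le0 ltW.
- move=> T'; rewrite inE => /predU1P[->|]; last exact: inv_small.
  by apply: le_trans Ssmall; rewrite ler_nat subset_leq_card.
Qed.

Lemma output_mpartition st (g : {set V} -> 'I_m) (U W : 'I_m -> {set V}) :
  loop_inv st -> mpartition (rest st) U ->
  (forall j, W j = U j :|: \bigcup_(T <- recorded st | g T == j) T) ->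
  mpartition [set: V] W.
Proof.
move=> inv [coverU disjU] WE.
have inW v j : v \in W j ->
    v \in U j \/ exists2 T, T \in recorded st & (g T == j) && (v \in T).
  rewrite WE inE => /orP[|]; first by left.
  by rewrite mem_bigcup_seq => /hasP[T Tr gT]; right; exists T.
have Wi v T : T \in recorded st -> v \in T -> v \in W (g T).
  move=> Tr vT; rewrite WE inE mem_bigcup_seq; apply/orP; right.
  by apply/hasP; exists T; rewrite ?eqxx.
have UR v j : v \in U j -> v \in rest st.
  by move=> vU; rewrite -coverU; apply/bigcupP; exists j.
split.
  apply/setP => v; rewrite inE; apply/bigcupP.
  have [|[T Tr vT]] := inv_cover inv v; last by exists (g T) => //; exact: Wi.
  by rewrite -coverU => /bigcupP[j _ vU]; exists j => //; rewrite WE inE vU.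
move=> i j ij; rewrite -setI_eq0; apply/eqP/setP => v; rewrite !inE.
apply/negP => /andP[/inW Wvi /inW Wvj].
have rT T : T \in recorded st -> v \in T -> v \in rest st -> False.
  move=> Tr vT vr; have /disjoint_setI0/setP/(_ v) := inv_rest inv Tr.
  by rewrite !inE vr vT.
(* Cases on whether [v] reaches each part through [V'] or through a recorded set. In the last one,
   two recorded sets sharing [v] coincide, so [g] gives the same index. *)
case: Wvi Wvj => [vUi|[T1 T1r /andP[/eqP g1 v1]]] [vUj|[T2 T2r /andP[/eqP g2 v2]]].
- have /disjoint_setI0/setP/(_ v) := disjU i j ij.
  by rewrite !inE vUi vUj.
- exact: rT T2r v2 (UR _ _ vUi).
- exact: rT T1r v1 (UR _ _ vUj).
- have [T12|T12] := eqVneq T1 T2; first by move: ij; rewrite -g1 -g2 T12 eqxx.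
  have /disjoint_setI0/setP/(_ v) := inv_disjoint inv T1r T2r T12.
  by rewrite !inE v1 v2.
Qed.

End Invariant.

(** * Success probability of the loop *)

Section LoopProbability.
Variables (R : realType) (V : finType) (f : {set V} -> R) (m : nat) (a d : R).
Variable sel : state V -> {set V} -> {set V}.
Hypotheses (f0 : 0 <= f set0) (selP : minimizer_rule f a sel) (d01 : 0 <= d <= 1).

Let prob (st : state V) : R := #|V|%:R / (m%:R * #|rest st|%:R).

Hypothesis prob01 : forall st : state V,
  m%:R * rho R #|V| < #|rest st|%:R -> 0 <= prob st <= 1.
Hypothesis progress : forall st : state V, m%:R * rho R #|V| < #|rest st|%:R ->
  d <= \sum_(S in powerset (rest st)) setwt (rest st) (prob st) S *
         (#|rest (step f m a sel st S)| < #|rest st|)%N%:R.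

Lemma card_rest_step (st : state V) (S : {set V}) :
  (#|rest (step f m a sel st S)| <= #|rest st|)%N.
Proof.
rewrite /step; case: ifP => // _; case: ifP => //= _.
exact/subset_leq_card/subsetDl.
Qed.

(* Potential argument: [2 ^+ #|rest st|] never increases, and halves with
   probability at least [d] in each iteration. *)
Lemma loop_success (E : option (state V) -> Prop) k (st : state V) :
  (forall st' : state V, loop_inv f m a st' ->
     #|rest st'|%:R <= m%:R * rho R #|V| -> E (Some st')) ->
  loop_inv f m a st ->
  1 - 2 ^+ #|rest st| * (1 - d / 2) ^+ k <= Pr (loop f m a sel k st) E.
Proof.
move=> EP; have /andP[d0 d1] := d01.
have exit (st' : state V) k' : loop_inv f m a st' ->
    ~~ (m%:R * rho R #|V| < #|rest st'|%:R) ->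
    1 - 2 ^+ #|rest st'| * (1 - d / 2) ^+ k' <= Pr (dret R (Some st')) E.
  move=> inv; rewrite -leNgt => h; rewrite Pr_dret; last exact: EP.
  by rewrite gerBl mulr_ge0 ?exprn_ge0 //; move: d0 d1; lra.
elim: k st => [|k IH] st inv /=; case: ifPn => h; try exact: exit.
  (* With no iteration left the claimed bound is at most 0, since the potential is at least 1. *)
  apply: le_trans (Pr_dret_ge0 _ _ _).
  by rewrite expr0 mulr1 subr_le0 exprn_ege1 // ler1n.
rewrite Pr_dbind (sum_drandset (rest st) (prob st)
  (fun S => Pr (loop f m a sel k (step f m a sel st S)) E)).
set P := (1 - d / 2) ^+ k.
have P0 : 0 <= P by rewrite exprn_ge0//; lra.
(* The factor [1 - 1 / 2] appears exactly when the draw shrinks [V']; averaging with [progress]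
   turns it into [1 - d / 2]. *)
apply: (@le_trans _ _ (\sum_(S in powerset (rest st)) setwt (rest st) (prob st) S *
   (1 - 2 ^+ #|rest st| * P * (1 - (#|rest (step f m a sel st S)| < #|rest st|)%N%:R / 2)))).
  under eq_bigr => S _.
    rewrite (_ : _ * _ = setwt (rest st) (prob st) S * (1 - 2 ^+ #|rest st| * P) +
      (2 ^+ #|rest st| * P / 2) * (setwt (rest st) (prob st) S *
        (#|rest (step f m a sel st S)| < #|rest st|)%N%:R)); last by field.
    over.
  rewrite big_split /= -mulr_suml sum_setwt -mulr_sumr mul1r.
  have c0 : 0 <= 2 ^+ #|rest st| * P / 2 by rewrite divr_ge0 // mulr_ge0 // exprn_ge0.
  have := ler_wpM2l c0 (progress h).
  by rewrite exprS -/P; lra.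
apply: ler_sum => S; rewrite powersetE => Sr.
apply: ler_wpM2l; first by apply: setwt_ge0; exact: prob01.
apply: le_trans (IH _ (step_inv f0 selP Sr inv)).
rewrite lerD2l lerN2 -/P mulrAC ler_wpM2r//.
case: ltnP => [hlt|_] /=; last first.
  by rewrite mul0r subr0 mulr1 ler_weXn2l ?ler1n// card_rest_step.
rewrite (_ : 1 - _ = 2^-1); last by field.
rewrite ler_pdivlMr// -exprSr ler_weXn2l ?ler1n//.
Qed.

End LoopProbability.

(** * Consequences of [ln n >= 400 * expR 3] *)

Section Asymptotics.
Variables (R : realType) (n : nat).
Hypothesis n_large : 400 * expR 3 <= ln n%:R :> R.
Notation l := (ln n%:R : R).

Lemma ln_large : 400 <= l.
Proof.
apply: le_trans n_large; rewrite ler_pMr ?ltr0n //.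
by apply: le_trans (expR_ge1Dx _); lra.
Qed.

Let N_gt0 : 0 < n%:R :> R.
Proof.
rewrite ltNge; apply/negP => n0; have := ln_large.
by rewrite ln0// => ?; lra.
Qed.

(** The cubic term of the exponential series is [(l / 2) ^ 3 / 6 = (l ^ 2 / 48) * l], and
    [l ^ 2 / 48 >= expR 3]. *)
Lemma ln_le_expR_half : expR 3 * l <= expR (l / 2).
Proof.
have l4 := ln_large; have L := n_large.
apply: le_trans (_ : (l / 2) ^+ 3 / 6 <= _).
  rewrite (_ : (l / 2) ^+ 3 / 6 = l ^+ 2 / 48 * l); last by field.
  by rewrite ler_pM2r; [nra|lra].
by have := @expR_ge1Dxn R (l / 2) 2 ltac:(lra); rewrite (_ : 3`! = 6)//; lra.
Qed.

Lemma rho_sqr : n%:R = rho R n ^+ 2 * l.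
Proof.
have l4 := ln_large.
rewrite /rho sqr_sqrtr ?divfK ?gt_eqF//; [lra|].
by rewrite divr_ge0//; lra.
Qed.

(** Squared, this is [16 * l ^ 3 <= n = expR l]; the quartic term [l ^ 4 / 24] suffices because
    [400 >= 16 * 24]. *)
Lemma rho_ge : 4 * l <= rho R n.
Proof.
have l4 := ln_large.
have l0 : 0 < l by lra.
rewrite /rho -[leLHS]ger0_norm; last by rewrite mulr_ge0 // ltW.
rewrite -sqrtr_sqr ler_wsqrtr // ler_pdivlMr // -[leRHS](@lnK R) ?posrE //.
have := expR_ge1Dxn 3 (ltW l0); rewrite (_ : 4`! = 24)// => h4; apply: le_trans h4.
have l3 : 400 * l ^+ 3 <= l * l ^+ 3 by rewrite ler_pM2r ?exprn_gt0.
have l30 : 0 < l ^+ 3 by rewrite exprn_gt0.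
rewrite [l ^+ 4]exprS; lra.
Qed.

Lemma sqrt_mulln : Num.sqrt (n%:R * l) = rho R n * l.
Proof.
have l4 := ln_large.
apply/eqP; rewrite -(@eqrXn2 _ 2)// ?sqrtr_ge0 ?mulr_ge0 ?sqrtr_ge0//; last by lra.
rewrite sqr_sqrtr; last by rewrite mulr_ge0//; lra.
by rewrite {1}rho_sqr; apply/eqP; ring.
Qed.

End Asymptotics.

Lemma alphaE (R : realType) (n m : nat) (B : R) : 400 * expR 3 <= ln n%:R :> R ->
  alpha n m B = B * m%:R / (rho R n * ln n%:R).
Proof. by move=> n_large; rewrite /alpha sqrt_mulln. Qed.

(** * Probability that one iteration shrinks [V'] *)

Lemma subset_of_card (V : finType) (X : {set V}) (a : nat) : (a <= #|X|)%N ->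
  exists2 A : {set V}, A \subset X & #|A| = a.
Proof.
move=> aX; exists [set x in take a (enum X)].
  by apply/subsetP => x; rewrite inE => /mem_take; rewrite mem_enum.
by rewrite cardsE (card_uniqP (take_uniq _ (enum_uniq _))) size_takel// -cardE.
Qed.

(** Pigeonhole, with the part whose trace on [W] is largest. *)
Lemma large_part (V : finType) (m : nat) (W : {set V}) (U : 'I_m -> {set V}) :
  (0 < m)%N -> \bigcup_j U j = [set: V] ->
  exists j, (#|W| <= m * #|W :&: U j|)%N.
Proof.
move=> m0 coverU; have [j _ maxj] := @eq_bigmax_cond _ predT (fun j => #|W :&: U j|)
  ltac:(by rewrite card_ord).
exists j; rewrite -maxj -[X in (X * _)%N](card_ord m) -sum_nat_const.
have WE : W = \bigcup_j (W :&: U j) by rewrite -big_distrr /= coverU setIT.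
rewrite {1}WE; apply: (@leq_trans (\sum_j #|W :&: U j|)).
  apply: (big_ind2 (fun (A : {set V}) k => (#|A| <= k)%N)) => [|A x C y hA hC|//].
    by rewrite cards0.
  by apply: leq_trans (leq_add hA hC); rewrite cardsU leq_subr.
by apply: leq_sum => i _; apply: leq_bigmax_cond.
Qed.

Section Progress.
Variables (R : realType) (V : finType) (f : {set V} -> R) (m : nat) (B : R).
Variables (sel : state V -> {set V} -> {set V}) (U : 'I_m -> {set V}).
Hypotheses (n_large : 400 * expR 3 <= ln #|V|%:R :> R).
Hypotheses (f_ge0 : forall A : {set V}, 0 <= f A) (f_mono : monotone_set f).
Hypotheses (m_large : 2 * rho R #|V| < m%:R) (B_gt0 : 0 < B).
Hypothesis selP : minimizer_rule f (alpha #|V| m B) sel.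
Hypotheses (coverU : \bigcup_j U j = [set: V]) (U_lt : forall j, f (U j) < B).

Variable st : state V.
Hypothesis in_loop : m%:R * rho R #|V| < #|rest st|%:R.

Notation N := (#|V|%:R : R).
Notation l := (ln N).
Notation rh := (rho R #|V|).
Notation a := (alpha #|V| m B).
Notation r := #|rest st|.

Let l1 : 1 <= l. Proof. by have := ln_large n_large; lra. Qed.
Let rho4 : 4 * l <= rh. Proof. exact: rho_ge. Qed.
Let N_gt0 : 0 < N.
Proof.
rewrite ltNge; apply/negP => n0; have := l1.
by rewrite ln0// => ?; lra.
Qed.
Let expl : expR l = N. Proof. by rewrite lnK. Qed.
Let rN : r%:R <= N. Proof. by rewrite ler_nat max_card. Qed.
Let rho_gt0 : 0 < rh. Proof. by move: l1 rho4; lra. Qed.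
Let m_gt0 : 0 < m%:R :> R. Proof. by move: rho_gt0 m_large; lra. Qed.
Let r_gt0 : 0 < r%:R :> R.
Proof. by apply: le_lt_trans in_loop; rewrite mulr_ge0// ltW. Qed.

Lemma sampling_prob : 0 <= N / (m%:R * r%:R) <= 1 / 2.
Proof.
exact: (loop_prob l1 rho4 expl (rho_sqr n_large) m_large in_loop).
Qed.

(** One subset with negative objective makes the minimum negative, so the chosen minimizer is
    nonempty and gets removed. *)
Lemma cheap_step (S T0 : {set V}) : S \subset rest st ->
  #|S|%:R <= 2 * N / m%:R -> T0 \subset S -> f T0 - a * #|T0|%:R < 0 ->
  (#|rest (step f m a sel st S)| < r)%N.
Proof.
move=> Sr Ssmall T0S T0neg; rewrite /step Ssmall.
have [TS /(_ _ T0S) Tmin] := selP st S.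
have Tneg := le_lt_trans Tmin T0neg.
have T_gt0 : (0 < #|sel st S|)%N by rewrite card_gt0; exact: cheap_neq0 (f_ge0 _) Tneg.
have Tr := subset_trans TS Sr.
by rewrite Tneg /= cardsDS // ltn_subrL T_gt0 (leq_trans T_gt0) // subset_leq_card.
Qed.

Lemma progress_prob :
  1 / (3 * N ^+ 2) <=
  \sum_(S in powerset (rest st)) setwt (rest st) (N / (m%:R * r%:R)) S *
    (#|rest (step f m a sel st S)| < r)%N%:R.
Proof.
have mN : (0 < m)%N by rewrite -(ltr0n R).
have [j hj] := large_part (rest st) mN coverU.
(* The ceiling of [r / m], which will be the size of [A]. *)
pose k := ((r + m.-1) %/ m)%N.
have kX : (k <= #|rest st :&: U j|)%N.
  by rewrite -ltnS ltn_divLR // mulSn (mulnC _ m); move: hj mN; clear; lia.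
have c1 : (r + m.-1 < k.+1 * m)%N by exact: ltn_ceil.
have c2 : (k * m <= r + m.-1)%N by exact: leq_trunc_div.
clearbody k.
have [A AX Ak] := subset_of_card kX.
have [AW AU] : A \subset rest st /\ A \subset U j.
  by split; apply: subset_trans AX _; rewrite ?subsetIl ?subsetIr.
have kb : r%:R / m%:R <= (k%:R : R) <= r%:R / m%:R + 1.
  have h1 : (r <= k * m)%N by move: c1 mN; rewrite mulSn; clear; lia.
  have h2 : (k * m <= r + m)%N by move: c2; clear; lia.
  move: h1 h2; rewrite -!(@ler_nat R) natrD !natrM => h1 h2.
  rewrite ler_pdivrMr// h1 /= -(@ler_pM2r _ m%:R)// mulrDl mul1r divfK//.
  by rewrite gt_eqF.
pose y := rh * l / m%:R.
have y0 : 0 <= y by rewrite divr_ge0// ?mulr_ge0// ltW// (lt_le_trans ltr01 l1).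
(* This [t] lies in the interval from [y] to [y + 1]: the lower bound makes the trace cheap, the
   upper one keeps it likely. *)
pose t := (Num.truncn y).+1.
have /andP[yt1 yt2] := truncn_itv y0.
have tb : y <= (t%:R : R) <= y + 1.
  by rewrite (ltW yt2) /t -natr1 lerD2r.
clearbody t.
have tsmall := loop_t_small l1 rho4 (rho_sqr n_large) m_large in_loop rN tb.
have bin := loop_binomial_ge l1 rho4 expl (rho_sqr n_large)
  (ln_le_expR_half n_large) m_large in_loop rN kb tb.
have /andP[q0 q1] := sampling_prob.
have Nm : 0 < N / m%:R by rewrite divr_gt0.
(* The room left outside [A]. Since [S] has mean size [N / m] and [L >= 3 / 2 * (N / m)], Markov
   fails with probability at most [2 / 3]. *)
pose L := 2 * N / m%:R - t%:R.
have L32 : 3 / 2 * (N / m%:R) <= L.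
  by rewrite /L; move: tsmall; lra.
have L0 : 0 < L by apply: lt_le_trans L32; rewrite mulr_gt0.
have q01 : 0 <= N / (m%:R * r%:R) <= 1 by rewrite q0; move: q1; lra.
apply: (@le_trans _ _ (\sum_(S in powerset (rest st))
  setwt (rest st) (N / (m%:R * r%:R)) S *
  ((#|S :&: A| == t) && (#|S :\: A|%:R <= L))%R%:R)).
  apply: le_trans (setwt_hit t AW q01 L0); rewrite Ak.
  have h3 : 1 / 3 <= 1 - N / (m%:R * r%:R) * r%:R / L.
    have -> : N / (m%:R * r%:R) * r%:R = N / m%:R.
      by field; rewrite !gt_eqF.
    have : N / m%:R / L <= 2 / 3 by rewrite ler_pdivrMr//; lra.
    lra.
  rewrite (_ : 1 / (3 * N ^+ 2) = 1 / N ^+ 2 * (1 / 3)); last first.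
    by field; rewrite gt_eqF.
  by apply: ler_pM bin h3; rewrite divr_ge0// exprn_ge0.
apply: ler_sum => S; rewrite powersetE => Sr.
apply: ler_wpM2l; first exact: setwt_ge0.
rewrite ler_nat; case: andP => // -[/eqP St SL].
rewrite (@cheap_step S (S :&: A)) ?subsetIl //.
  by rewrite -(cardsID A S) St natrD; move: SL; rewrite /L; lra.
have fT0 : f (S :&: A) < B.
  by apply: le_lt_trans (U_lt j); apply: f_mono; apply: subset_trans AU; exact: subsetIr.
(* [alpha * y = B], so [y <= t] yields [B <= alpha * t]. *)
rewrite subr_lt0 (lt_le_trans fT0)// St alphaE//.
have l0 : 0 < l by apply: lt_le_trans l1.
have /andP[tb1 _] := tb.
rewrite mulrAC ler_pdivlMr ?mulr_gt0// -(mulrA B) ler_pM2l//.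
by move: tb1; rewrite /y ler_pdivrMr // (mulrC t%:R).
Qed.

End Progress.

(** * Probability of exhausting the iteration bound *)

Lemma failure_le (R : realType) (n : nat) (p : R) :
  400 * expR 3 <= ln n%:R :> R -> 0 < p < 1 ->
  2 ^+ n * (1 - 1 / (3 * n%:R ^+ 2) / 2) ^+ Num.truncn (iter_bound n p) <= 1 - p.
Proof.
move=> n_large /andP[p0 p1].
have l4 := ln_large n_large.
have N0 : 0 < n%:R :> R.
  rewrite ltNge; apply/negP => n0; move: l4; rewrite ln0// => ?; lra.
have N1 : 1 <= n%:R :> R by move: N0; rewrite ltr0n -(@ler_nat R).
have q0 : 0 < 1 - p by lra.
have lE : ln (n%:R / (1 - p)) = ln n%:R - ln (1 - p) by rewrite ln_div.
have lam : ln (1 - p) <= 0 by apply: ln_le0; lra.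
set N : R := n%:R in n_large l4 N0 N1 lE *; set l := ln N in n_large l4 lE *.
set lb := ln (1 - p) in lE lam *.
set K := Num.truncn _.
have N3 : 1 <= N ^+ 3 by rewrite exprn_ege1.
(* [2 / c = 8 * sqrt (2 * pi) >= 8]; truncation loses at most 1, which one copy of
   [N ^ 3 * (l - lb) >= 1] absorbs. *)
have hK : 7 * N ^+ 3 * (l - lb) <= K%:R.
  have : 8 * N ^+ 3 * (l - lb) <= iter_bound n p.
    rewrite /iter_bound lE -/N ler_wpM2r; [by []|lra|].
    have s1 : 1 <= Num.sqrt (2 * pi) :> R.
      rewrite -[leLHS]sqrtr1 ler_wsqrtr//.
      by have := pi_ge2 R; lra.
    rewrite /cst_c div1r invrK.
    have : 1 * N ^+ 3 <= Num.sqrt (2 * pi) * N ^+ 3 by rewrite ler_pM2r//; lra.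
    lra.
  have : 1 * 1 <= N ^+ 3 * (l - lb) by apply: ler_pM => //; lra.
  have := truncnS_gt (iter_bound n p); rewrite -/K -natr1.
  lra.
have -> : 1 / (3 * N ^+ 2) / 2 = 1 / (6 * N ^+ 2) by field; rewrite gt_eqF.
set d := 1 / (6 * N ^+ 2).
have N2 : 1 <= N ^+ 2 by rewrite exprn_ege1.
have dle : d <= 1 by rewrite /d ler_pdivrMr; lra.
have e2 : 2 <= expR 1 :> R by apply: le_trans (expR_ge1Dx _); lra.
(* With [2 <= expR 1] and [1 - d <= expR (- d)], it remains to show [N - K * d <= lb]. *)
apply: (@le_trans _ _ (expR N * expR (- d) ^+ K)).
  apply: ler_pM; rewrite ?exprn_ge0//; [lra| |].
    rewrite /N -[n%:R]mulr1 expRM_natl; apply: lerXn2r; rewrite ?nnegrE// expR_ge0//.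
  apply: lerXn2r; rewrite ?nnegrE ?expR_ge0//; [lra|].
  exact: expR_ge1Dx.
rewrite -expRM_natl -expRD -[leRHS](@lnK R) ?posrE// ler_expR -/lb.
have : 7 / 6 * (N * (l - lb)) <= K%:R * d.
  rewrite /d div1r ler_pdivlMr; last by lra.
  by move: hK; lra.
have : N * 1 <= N * l by rewrite ler_pM2l//; lra.
have : 1 * (- lb) <= N * (- lb) by rewrite ler_wpM2r//; lra.
lra.
Qed.

(** * Load of the output parts *)

Section Outputs.
Variables (R : realType) (V : finType) (f : {set V} -> R) (m : nat) (B : R).
Hypotheses (n_large : 400 * expR 3 <= ln #|V|%:R :> R).
Hypotheses (f_ge0 : forall A : {set V}, 0 <= f A) (f_mono : monotone_set f).
Hypothesis f_sub : submodular f.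
Hypotheses (m_large : 2 * rho R #|V| < m%:R) (B_gt0 : 0 < B).
Hypothesis f_lt : forall v, f [set v] < B.

Notation N := (#|V|%:R : R).
Notation l := (ln N).
Notation rh := (rho R #|V|).
Notation a := (alpha #|V| m B).

Variable st : state V.
Hypothesis inv : loop_inv f m a st.

Let l400 : 400 <= l. Proof. exact: ln_large. Qed.
Let rho4 : 4 * l <= rh. Proof. exact: rho_ge. Qed.
Let rho_gt0 : 0 < rh. Proof. by move: l400 rho4; lra. Qed.
Let m_gt0 : 0 < m%:R :> R. Proof. by move: rho_gt0 m_large; lra. Qed.

Let alpha_gt0 : 0 < a.
Proof.
rewrite alphaE// divr_gt0// mulr_gt0//.
by move: l400; lra.
Qed.

(** Hence [3 * N / m] recorded elements cost [3 * rho * B], leaving [rho * B] for [U_j]. *)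
Let alpha_share : a * (N / m%:R) = rh * B.
Proof.
have l0 : 0 < l by move: l400; lra.
by rewrite alphaE// {2}(rho_sqr n_large); field; rewrite !gt_eqF.
Qed.

(** The bounds [u] and [tau] stay general because rounding trades a larger [u] for a smaller
    [tau]. *)
Lemma output_good (u tau : R) (g : {set V} -> 'I_m) (U W : 'I_m -> {set V}) :
  mpartition (rest st) U -> (forall j, #|U j|%:R <= u) ->
  (forall j, (\sum_(T <- recorded st | g T == j) #|T|)%N%:R <= tau) ->
  (forall j, W j = U j :|: \bigcup_(T <- recorded st | g T == j) T) ->
  B * u + a * tau <= 4 * rh * B ->
  good f B W.
Proof.
move=> partU Uu gtau WE le4; split; first exact: output_mpartition inv partU WE.
have B4 : B <= 4 * rh * B by rewrite ler_peMl ?ltW//; move: l400 rho4; lra.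
apply: bigmax_le => [|j _]; first exact: le_trans (ltW B_gt0) B4.
(* [ln 0 = 0] by convention, so [V] is nonempty; a singleton then bounds [f set0]. *)
have [v _] : exists v : V, v \in setT.
  apply/set0Pn; rewrite -card_gt0 cardsT -(ltr0n R) ltNge; apply/negP => n0.
  by move: l400; rewrite ln0// => ?; lra.
have f0 : f set0 <= B by apply: le_trans (ltW (f_lt v)); apply: f_mono; exact: sub0set.
rewrite WE; apply: le_trans (load_le f_ge0 f_sub _ _ (fun w => ltW (f_lt w)) f0 (inv_cheap inv)) _.
rewrite ge_max B4; apply: le_trans le4.
by apply: lerD; rewrite ler_pM2l.
Qed.

Lemma output_rho_good (W : 'I_m -> {set V}) : output rh st W -> good f B W.
Proof.
move=> [g [U [gtau partU Uu WE]]].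
apply: (output_good partU Uu gtau WE).
by rewrite -mulrA mulrCA alpha_share; move: B_gt0; lra.
Qed.

(* Rounding [rho] up costs at most [B] per part. If rounding is needed then
   [#|rest st| >= sqrt (n * ln n)], so that the greedy groups stay below
   [3 * n / m] by enough to compensate. *)
Lemma output_rho_up_good : #|rest st|%:R <= m%:R * rh ->
  exists W : 'I_m -> {set V}, output (rho_up R m st) st W /\ good f B W.
Proof.
move=> small.
have mN : (0 < m)%N by rewrite -(ltr0n R).
have [U [partU Uk]] := split_set (rest st) mN.
set k := ((#|rest st| + m.-1) %/ m)%N in Uk.
pose b := Num.truncn (2 * N / m%:R).
have b2 : b%:R <= 2 * N / m%:R.
  by rewrite /b truncn_le divr_ge0// mulr_ge0.
have [|g hg] := @balanced_assignment {set V} m b (fun T => #|T|) _ mN (inv_uniq inv).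
  move=> T /(inv_small inv) hT; rewrite -ltnS -(@ltr_nat R).
  exact: le_lt_trans hT (truncnS_gt _).
pose r : R := #|rest st|%:R.
have total : (\sum_(T <- recorded st) #|T|)%N%:R = N - r.
  by rewrite -(inv_card inv) natrD addrAC subrr add0r.
(* The average [(N - r) / m] plus at most one item, of size at most [2 * N / m]. *)
have gtau j : (\sum_(T <- recorded st | g T == j) #|T|)%N%:R <=
    3 * N / m%:R - r / m%:R.
  have := hg j; rewrite -(@ler_nat R) natrM natrD natrM total => h.
  rewrite -mulrBl ler_pdivlMr// mulrC; apply: le_trans h _.
  have : m.-1%:R * b%:R <= m%:R * (2 * N / m%:R) :> R.
    by rewrite ler_pM// ler_nat leq_pred.
  rewrite mulrCA divff ?gt_eqF// mulr1; lra.
exists (fun j => U j :|: \bigcup_(T <- recorded st | g T == j) T); split.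
  exists g, U; split=> // j.
    apply: le_trans (gtau j) _; rewrite gerBl divr_ge0//.
  by rewrite /rho_up le_max ler_nat Uk orbT.
apply: (output_good partU (u := k%:R) _ gtau) => //.
  by move=> j; rewrite ler_nat.
have l0 : 0 < l by move: l400; lra.
have -> : a * (3 * N / m%:R - r / m%:R) = 3 * rh * B - B * (r / (rh * l)).
  rewrite mulrBr -mulrA mulrCA alpha_share alphaE//; field.
  by rewrite !gt_eqF.
(* The term [r / (rh * l)] is the saving from [tau], in units of [B]. *)
suff : k%:R - r / (rh * l) <= rh.
  by move=> h; have := ler_wpM2l (ltW B_gt0) h; lra.
have [kr|kr] := leP k%:R rh.
  by rewrite lerBlDr (le_trans kr)// lerDl divr_ge0// ?mulr_ge0// ltW.
have km : k%:R * m%:R <= r + m%:R - 1.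
  have := leq_trunc_div (#|rest st| + m.-1) m; rewrite -/k -(@ler_nat R) natrM natrD.
  have -> : m.-1%:R = m%:R - 1 :> R by rewrite -[in RHS](prednK mN) -natr1 addrK.
  by rewrite addrA.
have k1 : k%:R <= rh + 1.
  by rewrite -(ler_pM2r m_gt0) mulrDl mul1r mulrC; move: km small; rewrite -/r; lra.
(* Here [k > rh] forces [r > m * (rh - 1) >= 2 * rh * (rh - 1) >= rh * l], so the saving pays for
   [k <= rh + 1]. *)
have : 1 <= r / (rh * l).
  rewrite ler_pdivlMr ?mulr_gt0// mul1r.
  have : rh * m%:R < k%:R * m%:R by rewrite ltr_pM2r.
  have : (2 * rh) * (rh - 1) <= m%:R * (rh - 1).
    by rewrite ler_wpM2r// ?ltW//; move: rho4 l400; lra.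
  have : rh * (l + 2) <= rh * (2 * rh) by rewrite ler_pM2l//; move: rho4 l400; lra.
  lra.
lra.
Qed.

End Outputs.

(** * Guarantee for the whole procedure *)

Theorem theorem19 (R : realType) :
  exists n0 : nat,
  forall (V : finType) (f : {set V} -> R) (m : nat) (B p : R)
         (sel : state V -> {set V} -> {set V}),
    (n0 <= #|V|)%N ->
    (forall A : {set V}, 0 <= f A) ->
    monotone_set f ->
    submodular f ->
    2 * rho R #|V| < m%:R ->
    0 < B ->
    0 < p < 1 ->
    minimizer_rule f (alpha #|V| m B) sel ->
    feasible f m B ->
    p <= Pr (sampling f m B p sel)
            (fun o : option (state V) =>
               exists st : state V,
                 [/\ o = Some st,
                     forall W : 'I_m -> {set V},
                       output (rho R #|V|) st W -> good f B W
                   & exists W : 'I_m -> {set V},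
                       output (rho_up R m st) st W /\ good f B W]).
Proof.
(* Chosen so that [ln n >= 400 * expR 3]. *)
exists (Num.truncn (expR (400 * expR 3) : R)).+1.
move=> V f m B p sel n_ge f_ge0 f_mono f_sub m_large B0 p01 selP [U [[coverU _] loadU]].
have n_large : 400 * expR 3 <= ln #|V|%:R :> R.
  rewrite -[leLHS]expRK; have nR : expR (400 * expR 3) <= #|V|%:R :> R.
    by apply: le_trans (ltW (truncnS_gt _)) _; rewrite ler_nat.
  by rewrite ler_ln ?posrE ?expR_gt0// (lt_le_trans _ nR)// expR_gt0.
have U_lt j : f (U j) < B by apply: le_lt_trans loadU; apply: le_bigmax.
have f_lt v : f [set v] < B.
  have : v \in [set: V] by rewrite inE.
  rewrite -coverU => /bigcupP[j _ vU]; apply: le_lt_trans (U_lt j).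
  by apply: f_mono; rewrite sub1set.
(* Feasibility and monotonicity rule out the initial failure test. *)
rewrite /sampling ifF; last first.
  by apply/negbTE; rewrite negb_exists; apply/forallP => v; rewrite -ltNge.
have N1 : 1 <= #|V|%:R :> R by rewrite ler1n (leq_trans _ n_ge).
have d01 : 0 <= (1 / (3 * #|V|%:R ^+ 2) : R) <= 1.
  have N2 : 1 <= #|V|%:R ^+ 2 :> R by rewrite exprn_ege1.
  have D0 : 0 < 3 * #|V|%:R ^+ 2 :> R by lra.
  apply/andP; split; first by rewrite divr_ge0 // ltW.
  by rewrite ler_pdivrMr //; lra.
have fail := failure_le n_large p01.
have : p <= 1 - (1 - p) by lra.
move=> /le_trans; apply; apply: (@le_trans _ _ (1 - 2 ^+ #|[set: V]| *
   (1 - 1 / (3 * #|V|%:R ^+ 2) / 2) ^+ Num.truncn (iter_bound #|V| p))).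
  by rewrite lerD2l lerN2 cardsT.
apply: (@loop_success _ _ f m (alpha #|V| m B) _ sel (f_ge0 _) selP d01 _ _ _ _
  (State [set: V] [::])) => /=.
- move=> st /(sampling_prob n_large m_large) /andP[-> h]; move: h; lra.
- by move=> st; apply: progress_prob coverU U_lt _.
- move=> st inv small; exists st; split=> //.
    exact: output_rho_good.
  exact: output_rho_up_good.
- exact: loop_inv0.
Qed.
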